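(* For any finite set $\mathcal E$ of correct equations between microCCS terms, there exist microCCS processes $P$ and $Q$ such that $P\sim Q$ but $P=Q$ is not derivable in equational logic from $\mathcal E$.
   Context: Fix an infinite set of names. MicroCCS processes: $\eta ::= a\mid\overline a$, $P::=\mathbf 0\mid \eta.P\mid P|Q$. Transitions: $\eta.P\xrightarrow{\eta}P$; if $P\xrightarrow{\eta}P'$, $Q\xrightarrow{\overline\eta}Q'$ then $P|Q\xrightarrow{\tau}P'|Q'$; if $P\xrightarrow{\mu}P'$ then $P|Q\xrightarrow{\mu}P'|Q$ and $Q|P\xrightarrow{\mu}Q|P'$ ($\mu$ is $\eta$ or $\tau$). Strong bisimilarity $\sim$ is the union of all symmetric relations $\mathcal R$ such that $P\mathcal RQ$, $P\xrightarrow{\mu}P'$ imply $Q\xrightarrow{\mu}Q'$ with $P'\mathcal RQ'$. MicroCCS terms with variables are given by $M::=\mathbf 0\mid\eta.M\mid M|M\mid X$ ($X$ ranging over variables); ground terms are terms without variables (i.e. processes). An equation is a pair $M=N$ of terms; it is correct if for every instantiation $\rho$ mapping variables to ground terms, $M\rho\sim N\rho$. Derivability from a set of equations $\mathcal E$ is in equational logic (reflexivity, symmetry, transitivity, closure under contexts and under instantiation of equations of $\mathcal E$). *)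

(* Defs.v *)
From mathcomp Require Import all_boot.
From mathcomp Require Import boolp classical_sets functions cardinality.

Set Implicit Arguments.
Unset Strict Implicit.
Unset Printing Implicit Defensive.

Inductive prefix (N : Type) : Type :=
| Name of N
| Coname of N.

Definition dual (N : Type) (eta : prefix N) : prefix N :=
  match eta with Name a => Coname a | Coname a => Name a end.

Inductive action (N : Type) : Type :=
| Act of prefix N
| Tau.
Arguments Tau {N}.

(* MicroCCS terms over the names N with variables in V. *)
Inductive term (N V : Type) : Type :=
| Nil
| Pre of prefix N & term N V
| Par of term N V & term N V
| Var of V.
Arguments Nil {N V}.
Arguments Var {N V}.

Definition process (N : Type) : Type := term N void.

Fixpoint subst (N V W : Type) (rho : V -> term N W) (M : term N V) :
    term N W :=
  match M with
  | Nil => Nil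
  | Pre eta M1 => Pre eta (subst rho M1)
  | Par M1 M2 => Par (subst rho M1) (subst rho M2)
  | Var X => rho X
  end.

(* A process contains no variable, so this only changes its type. *)
Definition term_of_process (N V : Type) : process N -> term N V :=
  subst (of_void (term N V)).

Inductive trans (N : Type) : process N -> action N -> process N -> Prop :=
| trans_pre eta P : trans (Pre eta P) (Act eta) P
| trans_com eta P P' Q Q' :
    trans P (Act eta) P' -> trans Q (Act (dual eta)) Q' ->
    trans (Par P Q) Tau (Par P' Q')
| trans_parl mu P P' Q :
    trans P mu P' -> trans (Par P Q) mu (Par P' Q)
| trans_parr mu P P' Q :
    trans P mu P' -> trans (Par Q P) mu (Par Q P').

Definition bisimulation (N : Type) (R : process N -> process N -> Prop) : Prop :=
  (forall P Q, R P Q -> R Q P) /\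
  (forall P Q mu P', R P Q -> trans P mu P' ->
     exists2 Q', trans Q mu Q' & R P' Q').

Definition bisimilar (N : Type) (P Q : process N) : Prop :=
  exists2 R, bisimulation R & R P Q.

Definition equation (N V : Type) : Type := (term N V * term N V)%type.

Definition correct (N V : Type) (e : equation N V) : Prop :=
  forall rho : V -> process N, bisimilar (subst rho e.1) (subst rho e.2).

Inductive derivable (N V : Type) (E : set (equation N V)) :
    term N V -> term N V -> Prop :=
| derivable_refl M : derivable E M M
| derivable_sym M1 M2 : derivable E M1 M2 -> derivable E M2 M1
| derivable_trans M1 M2 M3 :
    derivable E M1 M2 -> derivable E M2 M3 -> derivable E M1 M3
| derivable_pre eta M1 M2 :
    derivable E M1 M2 -> derivable E (Pre eta M1) (Pre eta M2)
| derivable_par M1 M2 M1' M2' :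
    derivable E M1 M1' -> derivable E M2 M2' ->
    derivable E (Par M1 M2) (Par M1' M2')
| derivable_inst (e : equation N V) (sigma : V -> term N V) :
    E e -> derivable E (subst sigma e.1) (subst sigma e.2).

(* Main.v *)
Require Import Defs.
From mathcomp Require Import all_boot.
From mathcomp Require Import boolp classical_sets functions cardinality.
(* Defs is imported again because seq redefines [prefix] and [Nil]. *)
Import Defs.
Local Open Scope classical_set_scope.

Set Implicit Arguments.
Unset Strict Implicit.
Unset Printing Implicit Defensive.

(** Pick a name [a] occurring in no equation of [E], and let [chop a] replace
    every subterm [a.P] by [a.0]. Since the equations do not mention [a],
    chopping an instance of an equation yields another instance of it, so
    derivable terms stay bisimilar after chopping. But [a.a.0 ~ a.0 | a.0],
    whereas their choppings [a.0] and [a.0 | a.0] are not bisimilar. *)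

(** * Bisimilarity as an equivalence relation *)

Section Bisimilarity.
Variable N : Type.
Implicit Types (P Q S : process N) (mu : action N) (eta : prefix N).

Lemma bisimulation_bisimilar : bisimulation (@bisimilar N).
Proof.
split=> [P Q [R [symR simR] RPQ]|P Q mu P' [R [symR simR] RPQ] PP'].
  by exists R => //; exact: symR.
have [Q' QQ' RPQ'] := simR _ _ _ _ RPQ PP'.
by exists Q' => //; exists R.
Qed.

Lemma bisimilar_sym P Q : bisimilar P Q -> bisimilar Q P.
Proof. exact: bisimulation_bisimilar.1. Qed.

Lemma bisimilar_trans_l P Q mu P' : bisimilar P Q -> trans P mu P' ->
  exists2 Q', trans Q mu Q' & bisimilar P' Q'.
Proof. exact: bisimulation_bisimilar.2. Qed.

(** The union of [R], its converse and bisimilarity is a bisimulation. Hence a candidate [R] need be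
    neither symmetric nor closed under transitions that end in processes already known to be
    bisimilar. *)
Lemma bisimilar_up_to (R : process N -> process N -> Prop) :
  (forall P Q mu P', R P Q -> trans P mu P' ->
     exists2 Q', trans Q mu Q' & R P' Q' \/ bisimilar P' Q') ->
  (forall P Q mu Q', R P Q -> trans Q mu Q' ->
     exists2 P', trans P mu P' & R P' Q' \/ bisimilar P' Q') ->
  forall P Q, R P Q -> bisimilar P Q.
Proof.
move=> simR simR' P Q RPQ.
exists (fun S T => R S T \/ R T S \/ bisimilar S T); last by left.
split=> [S T [|[|]]|S T mu S' [RST|[RTS|ST]] SS']; first by right; left.
- by left.
- by move=> /bisimilar_sym; right; right.
- have [T' TT' RST'] := simR _ _ _ _ RST SS'; exists T' => //.
  by case: RST' => ?; [left|right; right].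
- have [T' TT' RTS'] := simR' _ _ _ _ RTS SS'; exists T' => //; right.
  by case: RTS' => [|/bisimilar_sym] ?; [left|right].
- have [T' TT' ST'] := bisimilar_trans_l ST SS'.
  by exists T' => //; right; right.
Qed.

Lemma bisimilar_refl P : bisimilar P P.
Proof.
by apply: (@bisimilar_up_to eq) => // {}P _ mu S <- ?; exists S => //; left.
Qed.

Lemma bisimilar_trans Q P S :
  bisimilar P Q -> bisimilar Q S -> bisimilar P S.
Proof.
move=> PQ QS.
apply: (@bisimilar_up_to (fun P S => exists2 Q, bisimilar P Q & bisimilar Q S));
  last by exists Q.
- move=> {PQ QS}P {}S mu P' [{}Q PQ QS] PP'.
  have [Q' QQ' PQ'] := bisimilar_trans_l PQ PP'.
  have [S' SS' QS'] := bisimilar_trans_l QS QQ'.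
  by exists S' => //; left; exists Q'.
- move=> {PQ QS}P {}S mu S' [{}Q /bisimilar_sym QP /bisimilar_sym SQ] SS'.
  have [Q' QQ' /bisimilar_sym SQ'] := bisimilar_trans_l SQ SS'.
  have [P' PP' /bisimilar_sym QP'] := bisimilar_trans_l QP QQ'.
  by exists P' => //; left; exists Q'.
Qed.

(** * Inversion of transitions and congruence *)

Lemma trans_Nil mu P : ~ trans Nil mu P.
Proof. by move=> h; inversion h. Qed.

Lemma trans_Pre_inv eta P mu S : trans (Pre eta P) mu S -> mu = Act eta /\ S = P.
Proof. by move=> h; inversion h. Qed.

Lemma trans_Par_inv P Q mu S : trans (Par P Q) mu S ->
  [\/ exists eta P' Q', [/\ mu = Tau, S = Par P' Q',
        trans P (Act eta) P' & trans Q (Act (dual eta)) Q'],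
      exists2 P', S = Par P' Q & trans P mu P' |
      exists2 Q', S = Par P Q' & trans Q mu Q'].
Proof.
move=> h; inversion h as [|eta ? P' ? Q'|? ? P'|? ? Q']; subst.
- by apply: Or31; exists eta, P', Q'.
- by apply: Or32; exists P'.
- by apply: Or33; exists Q'.
Qed.

Lemma bisimilar_Pre eta P Q : bisimilar P Q -> bisimilar (Pre eta P) (Pre eta Q).
Proof.
move=> PQ; apply: (@bisimilar_up_to (fun S T => S = Pre eta P /\ T = Pre eta Q))
  => // S T mu S' [-> ->] /trans_Pre_inv[-> ->].
- by exists Q; [exact: trans_pre|right].
- by exists P; [exact: trans_pre|right].
Qed.

Lemma bisimilar_Par P Q P' Q' :
  bisimilar P P' -> bisimilar Q Q' -> bisimilar (Par P Q) (Par P' Q').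
Proof.
(* Every transition of a parallel composition leads to a parallel composition, so this relation is a
   bisimulation as it stands. *)
pose R S T := exists P P' Q Q',
  [/\ S = Par P Q, T = Par P' Q', bisimilar P P' & bisimilar Q Q'].
have symR S T : R S T -> R T S.
  by move=> [A [A' [B [B' [-> -> AA BB]]]]]; exists A', A, B', B;
    split=> //; exact: bisimilar_sym.
have simR S T mu S' : R S T -> trans S mu S' ->
    exists2 T', trans T mu T' & R S' T'.
  move=> [A [A' [B [B' [-> -> AA BB]]]]] /trans_Par_inv[].
  - move=> [eta [A1 [B1 [-> -> AA1 BB1]]]].
    have [A2 AA2 ?] := bisimilar_trans_l AA AA1.
    have [B2 BB2 ?] := bisimilar_trans_l BB BB1.
    by exists (Par A2 B2); [exact: trans_com AA2 BB2|exists A1, A2, B1, B2].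
  - move=> [A1 -> AA1]; have [A2 AA2 ?] := bisimilar_trans_l AA AA1.
    by exists (Par A2 B'); [exact: trans_parl|exists A1, A2, B, B'].
  - move=> [B1 -> BB1]; have [B2 BB2 ?] := bisimilar_trans_l BB BB1.
    by exists (Par A' B2); [exact: trans_parr|exists A, A', B1, B2].
by move=> PP QQ; exists R; [split|exists P, P', Q, Q'].
Qed.

(** * Unit laws and the distinguishing pair *)

Lemma bisimilar_ParNil P : bisimilar (Par P Nil) P.
Proof.
apply: (@bisimilar_up_to (fun S T => S = Par T Nil)) => // S T mu S' ->.
- move=> /trans_Par_inv[[? [? [? [_ _ _ /trans_Nil]]]]|[P' -> TP']|
    [? _ /trans_Nil]] //.
  by exists P' => //; left.
- by exists (Par S' Nil); [exact: trans_parl|left].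
Qed.

Lemma bisimilar_NilPar P : bisimilar (Par Nil P) P.
Proof.
apply: (@bisimilar_up_to (fun S T => S = Par Nil T)) => // S T mu S' ->.
- move=> /trans_Par_inv[[? [? [? [_ _ /trans_Nil]]]]|[? _ /trans_Nil]|
    [P' -> TP']] //.
  by exists P' => //; left.
- by exists (Par Nil S'); [exact: trans_parr|left].
Qed.

(** Either side can only perform [eta], and one copy of [eta.0] then remains, up to a parallel
    [Nil]. *)
Lemma bisimilar_Pre_Pre eta :
  bisimilar (Pre eta (Pre eta Nil)) (Par (Pre eta Nil) (Pre eta Nil)).
Proof.
set u := Pre eta Nil.
apply: (@bisimilar_up_to (fun S T => S = Pre eta u /\ T = Par u u)) => //
  S T mu S' [-> ->].
- move=> /trans_Pre_inv[-> ->]; exists (Par Nil u).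
    by apply: trans_parl; exact: trans_pre.
  by right; apply/bisimilar_sym/bisimilar_NilPar.
- move=> /trans_Par_inv[].
  (* The two copies cannot communicate, since no prefix is its own dual. *)
  + move=> [eta' [? [? [_ _ /trans_Pre_inv[[->] _] /trans_Pre_inv[[]]]]]].
    by case: (eta).
  + move=> [? -> /trans_Pre_inv[-> ->]]; exists u; first exact: trans_pre.
    by right; apply/bisimilar_sym/bisimilar_NilPar.
  + move=> [? -> /trans_Pre_inv[-> ->]]; exists u; first exact: trans_pre.
    by right; apply/bisimilar_sym/bisimilar_ParNil.
Qed.

(** The composition can perform [eta] twice in a row, the single prefix only once. *)
Lemma not_bisimilar_Par_idem eta :
  ~ bisimilar (Pre eta Nil) (Par (Pre eta Nil) (Pre eta Nil)).
Proof.
move=> /bisimilar_sym uu.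
have [Q1 /trans_Pre_inv[_ ->] h] :=
  bisimilar_trans_l uu (trans_parl (Pre eta Nil) (trans_pre eta Nil)).
by have [Q2 /trans_Nil] :=
  bisimilar_trans_l h (trans_parr Nil (trans_pre eta Nil)).
Qed.

End Bisimilarity.

(** * Chopping below a fresh name *)

Section Chop.
Context {N V : Type}.
Implicit Types (a : N) (M : term N V) (E : set (equation N V)).

Definition prefix_name (eta : prefix N) : N :=
  match eta with Name a => a | Coname a => a end.

Fixpoint names M : set N :=
  match M with
  | Nil => set0
  | Pre eta M1 => prefix_name eta |` names M1
  | Par M1 M2 => names M1 `|` names M2
  | Var _ => set0
  end.

Lemma finite_names M : finite_set (names M).
Proof.
elim: M => [|eta M IH|M1 IH1 M2 IH2|X] //=.
by rewrite finite_setU; split=> //; exact: finite_set1.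
by rewrite finite_setU.
Qed.

Lemma fresh_name E : infinite_set [set: N] -> finite_set E ->
  exists a, forall e, E e -> ~ names e.1 a /\ ~ names e.2 a.
Proof.
move=> infN finE.
have finU : finite_set (\bigcup_(e in E) (names e.1 `|` names e.2)).
  apply: bigcup_finite => // e _.
  by rewrite finite_setU; split; exact: finite_names.
(* If every name occurred in some equation, the finite union [finU] would exhaust [N]. *)
apply: contrapT => /forallNP nofresh; apply: infN; apply: sub_finite_set finU.
move=> a _; apply: contrapT => aU; apply: (nofresh a) => e Ee.
by split=> ae; apply: aU; exists e => //; [left|right].
Qed.

(** A derivation between processes may pass through open terms; sending variables to [Nil] makes
    every chopped term a process, so that bisimilarity applies to it. *)
Fixpoint chop a M : process N :=
  match M with
  | Nil => Nil
  | Pre eta M1 => Pre eta (if `[< eta = Name a >] then Nil else chop a M1)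
  | Par M1 M2 => Par (chop a M1) (chop a M2)
  | Var _ => Nil
  end.

(** No prefix of [M] itself triggers a cut, so chopping acts only inside the substituted terms. *)
Lemma chop_subst a (sigma : V -> term N V) M : ~ names M a ->
  chop a (subst sigma M) = subst (chop a \o sigma) M.
Proof.
elim: M => [|eta M IH|M1 IH1 M2 IH2|X] //=.
- move=> /not_orP[eta_a /IH ->].
  by rewrite asboolF// => eta_eq; apply: eta_a; rewrite eta_eq.
- by move=> /not_orP[/IH1 -> /IH2 ->].
Qed.

Lemma derivable_chop a E M1 M2 :
  (forall e, E e -> correct e) ->
  (forall e, E e -> ~ names e.1 a /\ ~ names e.2 a) ->
  derivable E M1 M2 -> bisimilar (chop a M1) (chop a M2).
Proof.
move=> corE freshE; elim=> /=.
- by move=> M; exact: bisimilar_refl.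
- by move=> ? ? _ /bisimilar_sym.
- by move=> ? M ? _ h1 _; exact: bisimilar_trans.
(* Under the prefix [a] both continuations become [Nil]; under any other prefix the induction
   hypothesis applies. *)
- move=> eta ? ? _ h; apply: bisimilar_Pre.
  by case: ifP => // _; exact: bisimilar_refl.
- by move=> ? ? ? ? _ h1 _; exact: bisimilar_Par.
(* The chopped sides are the instances of [e] under the ground instantiation [chop a \o sigma], to
   which correctness applies. *)
- move=> e sigma Ee; have [fr1 fr2] := freshE _ Ee.
  by rewrite !chop_subst//; exact: corE.
Qed.

End Chop.

Theorem theorem3p9 (N V : Type) (infN : infinite_set [set: N])
    (E : set (equation N V)) (finE : finite_set E)
    (corE : forall e, E e -> correct e) :
  exists P Q : process N,
    bisimilar P Q /\
    ~ derivable E (term_of_process V P) (term_of_process V Q).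
Proof.
have [a freshE] := fresh_name infN finE.
exists (Pre (Name a) (Pre (Name a) Nil)).
exists (Par (Pre (Name a) Nil) (Pre (Name a) Nil)).
split; first exact: bisimilar_Pre_Pre.
(* Chopping turns [a.a.0] into [a.0] and leaves [a.0 | a.0] unchanged. *)
move=> /(derivable_chop corE freshE) /=.
by rewrite asboolT//; exact: not_bisimilar_Par_idem.
Qed.
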